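(* Let $d$ be a positive integer. (1) $\mathbb{A}^d_q(\Lambda)$ is an $\mathbb{N}$-graded associative $\mathbb{Q}[q]$-algebra with unit, whose $n$-th component is a free $\mathbb{Q}[q]$-module with basis $\Lambda_n$. (2) Let $m,n$ be positive integers, $\mu\in\Lambda_m$, $\nu\in\Lambda_n$. The product of $\mu$ with $\nu$ in $\mathbb{A}^d_q(\Lambda)$ is $$\mu\ast\nu=\sum_{\mathbf a\in\mathbb{N}^m,\ \mathbf b\in\mathbb{N}^n}c_{m,n}^{\mathbf a,\mathbf b}\,(\mu+\mathbf a,\nu+\mathbf b)_{\le}.$$
   Context: $\mathbb{N}=\{0,1,2,\ldots\}$, $q$ is an indeterminate, and $d$ is a fixed positive integer. Partitions: a partition of length $n$ is a vector $\lambda\in\mathbb{N}^n$ with $\lambda_1\le\cdots\le\lambda_n$ (zero entries allowed). $\Lambda_n$ is the set of partitions of length $n$, and $\Lambda=\bigsqcup_{n\ge0}\Lambda_n$. For $\mu\in\mathbb{N}^n$, $\mu_{\le}\in\Lambda_n$ is the increasing rearrangement of $\mu$. The coefficients: for positive integers $m,n$, the elements $c_{m,n}^{\mathbf a,\mathbf b}\in\mathbb{Q}[q]$ ($\mathbf a\in\mathbb{N}^m$, $\mathbf b\in\mathbb{N}^n$) are defined by $$\prod_{s=m+1}^{m+n}\prod_{t=1}^m(x_s-qx_t)^{d-1}=\sum_{\mathbf a\in\mathbb{N}^m,\ \mathbf b\in\mathbb{N}^n}c_{m,n}^{\mathbf a,\mathbf b}\,x_1^{a_1}\cdots x_m^{a_m}x_{m+1}^{b_1}\cdots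 x_{m+n}^{b_n}.$$ The algebra $\mathbb{A}^d_q(\hat\Lambda)$: let $\hat\Lambda=\bigsqcup_{n\ge0}\mathbb{N}^n$, with $\emptyset$ the unique element of $\mathbb{N}^0$. $\mathbb{A}^d_q(\hat\Lambda)$ is the free $\mathbb{Q}[q]$-module with basis $\hat\Lambda$, with $\mathbb{Q}[q]$-bilinear multiplication for which $\emptyset\ast\mu=\mu=\mu\ast\emptyset$ and, for $\mu\in\mathbb{N}^m$, $\nu\in\mathbb{N}^n$ with $m,n\ge1$, $\mu\ast\nu=\sum_{\mathbf a\in\mathbb{N}^m,\mathbf b\in\mathbb{N}^n}c_{m,n}^{\mathbf a,\mathbf b}(\mu+\mathbf a,\nu+\mathbf b)$, where $(\cdot,\cdot)$ denotes concatenation. It is graded, with $n$-th component the free $\mathbb{Q}[q]$-module with basis $\mathbb{N}^n$. The algebra $\mathbb{A}^d_q(\Lambda)$: it is the quotient of $\mathbb{A}^d_q(\hat\Lambda)$ by the two-sided ideal generated by all differences (taken in the module $\mathbb{A}^d_q(\hat\Lambda)$) of basis elements $\mu,\nu\in\hat\Lambda$ such that $\mu$ is a permutation of $\nu$. A partition $\lambda\in\Lambda\subset\hat\Lambda$ is identified with its class in the quotient, and the grading is the induced one. *)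

(* Defs.v *)
From HB Require Import structures.
From mathcomp Require Import all_boot all_order all_algebra.
From mathcomp Require Import finmap.
From mathcomp Require Import boolp classical_sets functions cardinality fsbigop.
(* monalg and mpoly export the same names (mcoeff, msupp) and notations; mpoly
   is imported last and the monalg versions are used qualified. The notation
   {mpoly R[n]} denotes the monalg type, hence mpoly.mpoly n R below. *)
From mathcomp Require Import monalg.
From mathcomp Require Import mpoly.

Set Implicit Arguments.
Unset Strict Implicit.
Unset Printing Implicit Defensive.

Import GRing.Theory Quotient.

Local Open Scope classical_set_scope.
Local Open Scope quotient_scope.
Local Open Scope ring_scope.

(* The indeterminate q of Q[q] is the variable 'X of {poly rat}. *)
Notation Qq := {poly rat}.

Section FreeModules.
Variables (R : nzRingType) (I : choiceType).

(* {malg R[I]} is the free R-module on I: the finitely supported functions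
   I -> R. Only its module structure is used here. *)
Definition lcomb (V : lmodType R) (e : I -> V) (x : {malg R[I]}) : V :=
  \sum_(i <- monalg.msupp x) monalg.mcoeff i x *: e i.

Definition is_basis (V : lmodType R) (W : set V) (e : I -> V) : Prop :=
  (forall x : {malg R[I]}, lcomb e x = 0 -> x = 0)
  /\ W = range (lcomb e).

Lemma lcombEw (V : lmodType R) (e : I -> V) (x : {malg R[I]}) (D : {fset I}) :
  (monalg.msupp x `<=` D)%fset ->
  lcomb e x = \sum_(i <- D) monalg.mcoeff i x *: e i.
Proof.
move=> sxD; rewrite /lcomb; apply: big_fset_incl => // i _ /mcoeff_outdom ->.
by rewrite scale0r.
Qed.

Lemma lcomb_linear (V : lmodType R) (e : I -> V) : linear (lcomb e).
Proof.
move=> a x y.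
pose D := (monalg.msupp x `|` monalg.msupp y `|` monalg.msupp (a *: x + y))%fset.
rewrite (@lcombEw _ _ (a *: x + y) D) ?fsubsetUr //.
rewrite (@lcombEw _ _ x D) ?(@lcombEw _ _ y D).
- rewrite scaler_sumr -big_split; apply: eq_bigr => i _ /=.
  by rewrite monalg.mcoeffD monalg.mcoeffZ scalerDl scalerA.
- by rewrite /D (fsubset_trans (fsubsetUr _ _) (fsubsetUl _ _)).
- by rewrite /D (fsubset_trans (fsubsetUl _ _) (fsubsetUl _ _)).
Qed.

End FreeModules.

Section Gradings.
Variables (R : nzRingType) (V : lmodType R).

Definition is_submodule (W : set V) : Prop :=
  [/\ W 0, forall x y, W x -> W y -> W (x + y)
    & forall (a : R) x, W x -> W (a *: x)].

Definition is_direct_sum (C : nat -> set V) : Prop :=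
  (forall x, exists n (f : nat -> V),
     (forall i, C i (f i)) /\ x = \sum_(i < n) f i)
  /\ (forall n (f : nat -> V), (forall i, C i (f i)) ->
     \sum_(i < n) f i = 0 -> forall i, (i < n)%N -> f i = 0).

Definition is_assoc_unital_algebra (mul : V -> V -> V) (one : V) : Prop :=
  [/\ left_distributive mul +%R /\ right_distributive mul +%R,
      forall (a : R) x y, mul (a *: x) y = a *: mul x y,
      forall (a : R) x y, mul x (a *: y) = a *: mul x y,
      associative mul
    & left_id one mul /\ right_id one mul].

Definition is_algebra_grading (mul : V -> V -> V) (one : V)
    (C : nat -> set V) : Prop :=
  [/\ forall n, is_submodule (C n),
      is_direct_sum C,
      C 0%N one
    & forall m n x y, C m x -> C n y -> C (m + n)%N (mul x y)].

End Gradings.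

Definition Lambda (n : nat) := {l : n.-tuple nat | sorted leq l}.

Lemma sort_leq_sorted n (t : n.-tuple nat) :
  sorted leq [tuple of sort leq t].
Proof. exact: (sort_sorted leq_total). Qed.

Definition incr_rearr n (t : n.-tuple nat) : Lambda n :=
  exist _ [tuple of sort leq t] (sort_leq_sorted t).

Definition tadd n (s t : n.-tuple nat) : n.-tuple nat :=
  [tuple (tnth s i + tnth t i)%N | i < n].

(* The polynomials are over Q[q], in the variables x_1, ..., x_(m+n):
   x_t (t <= m) is 'X_(lshift n t) and x_(m+s) is 'X_(rshift m s). *)
Definition cpoly (d m n : nat) : mpoly.mpoly (m + n) Qq :=
  \prod_(s < n) \prod_(t < m)
    ('X_(rshift m s) - ('X : Qq) *: 'X_(lshift n t)) ^+ d.-1.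

Definition ccoef (d m n : nat) (a : m.-tuple nat) (b : n.-tuple nat) : Qq :=
  mpoly.mcoeff (Multinom [tuple of a ++ b]) (cpoly d m n).

(* The disjoint union of the N^n is represented by [seq nat], the elements of
   N^n being the sequences of size n. *)
Notation hatA := {malg Qq[seq nat]}.

Definition hbasis (u : seq nat) : hatA := monalg.mkmalgU u 1.

Definition hstar (d : nat) (u v : seq nat) : hatA :=
  if u is [::] then hbasis v else
  if v is [::] then hbasis u else
  \sum_(ab \in [set: (size u).-tuple nat * (size v).-tuple nat])
    ccoef d ab.1 ab.2 *:
      hbasis (tadd (in_tuple u) ab.1 ++ tadd (in_tuple v) ab.2).

Definition hmul (d : nat) (x y : hatA) : hatA :=
  lcomb (fun u => lcomb (fun v => hstar d u v) y) x.

Definition hcomp (n : nat) : set hatA :=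
  [set x | forall u, u \in monalg.msupp x -> size u = n].

Definition two_sided_ideal (d : nat) (J : set hatA) : Prop :=
  is_submodule J
  /\ (forall x y, J y -> J (hmul d x y) /\ J (hmul d y x)).

Definition perm_differences : set hatA :=
  [set x | exists u v, perm_eq u v /\ x = hbasis u - hbasis v].

Definition perm_ideal (d : nat) : set hatA :=
  smallest (two_sided_ideal d) perm_differences.

Lemma perm_ideal_two_sided d : two_sided_ideal d (perm_ideal d).
Proof.
split; first split.
- by move=> J [[[]]].
- move=> x y Ix Iy J HJ; have [[[_ addJ _] _] _] := HJ.
  exact: addJ (Ix _ HJ) (Iy _ HJ).
- move=> a x Ix J HJ; have [[[_ _ scaleJ] _] _] := HJ.
  exact: scaleJ (Ix _ HJ).
- move=> x y Iy; split=> J HJ; have [[_ mulJ] _] := HJ;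
    by case: (mulJ x y (Iy _ HJ)).
Qed.

Definition perm_pred (d : nat) : {pred hatA} := fun x => `[< perm_ideal d x >].

Lemma perm_pred_zmod_closed d : zmod_closed (perm_pred d).
Proof.
have [[I0 addI scaleI] _] := perm_ideal_two_sided d.
split=> [|x y /asboolP Ix /asboolP Iy]; apply/asboolP => //.
by apply: addI => //; rewrite -scaleN1r; apply: scaleI.
Qed.

HB.instance Definition _ d :=
  GRing.isZmodClosed.Build hatA (perm_pred d) (perm_pred_zmod_closed d).

(* The quotient module; its Q[q]-action and product are defined on
   representatives, and [pi_Ascale], [pi_Amul] show that they are the induced
   ones. *)
Definition Aq (d : nat) := {quot (perm_pred d : zmodClosed hatA)}.
HB.instance Definition _ d := EqQuotient.on (Aq d).
HB.instance Definition _ d := GRing.Zmodule.on (Aq d).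

Definition cls (d : nat) (x : hatA) : Aq d := \pi_(Aq d) x.

Lemma cls_eq d x y : cls d x = cls d y <-> perm_ideal d (x - y).
Proof.
rewrite /cls; split=> [/eqP|Ixy].
  by rewrite -idealrBE => /asboolP.
by apply/eqP; rewrite -idealrBE; apply/asboolP.
Qed.

Lemma cls_repr d (x : Aq d) : cls d (repr x) = x.
Proof. exact: reprK. Qed.

Lemma clsD d x y : cls d (x + y) = cls d x + cls d y.
Proof. exact: pi_add. Qed.

Lemma repr_cls d x : perm_ideal d (repr (cls d x) - x).
Proof. by apply/cls_eq; rewrite cls_repr. Qed.

Definition Ascale (d : nat) (a : Qq) (x : Aq d) : Aq d := cls d (a *: repr x).

Lemma pi_Ascale d a x : cls d (a *: x) = Ascale a (cls d x).
Proof.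
apply/esym/cls_eq; rewrite -scalerBr.
have [[_ _ scaleI] _] := perm_ideal_two_sided d.
by apply: scaleI; exact: repr_cls.
Qed.

Lemma AscaleA d a b (x : Aq d) : Ascale a (Ascale b x) = Ascale (a * b) x.
Proof. by rewrite -[x]cls_repr -!pi_Ascale scalerA. Qed.

Lemma Ascale1 d (x : Aq d) : Ascale 1 x = x.
Proof. by rewrite /Ascale scale1r cls_repr. Qed.

Lemma AscaleDr d a : {morph @Ascale d a : x y / x + y}.
Proof.
move=> x y; rewrite -[x]cls_repr -[y]cls_repr -clsD -!pi_Ascale.
by rewrite scalerDr clsD.
Qed.

Lemma AscaleDl d (x : Aq d) : {morph (Ascale (d := d))^~ x : a b / a + b}.
Proof.
by move=> a b; rewrite -[x]cls_repr -!pi_Ascale scalerDl clsD.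
Qed.

HB.instance Definition _ d := GRing.Zmodule_isLmodule.Build Qq (Aq d)
  (@AscaleA d) (@Ascale1 d) (@AscaleDr d) (@AscaleDl d).

Definition Amul (d : nat) (x y : Aq d) : Aq d := cls d (hmul d (repr x) (repr y)).

Definition Aone (d : nat) : Aq d := cls d (hbasis [::]).

Definition Acomp (d n : nat) : set (Aq d) := cls d @` hcomp n.

Arguments Acomp d n : clear implicits.

Definition pcls (d n : nat) (l : Lambda n) : Aq d := cls d (hbasis (val l)).

Lemma hmulDl d x y z : hmul d (x + y) z = hmul d x z + hmul d y z.
Proof.
by rewrite /hmul -[x in LHS]scale1r lcomb_linear scale1r.
Qed.

Lemma hmulDr d x y z : hmul d x (y + z) = hmul d x y + hmul d x z.
Proof.
rewrite /hmul {1 3 5}/lcomb -big_split; apply: eq_bigr => u _ /=.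
by rewrite -[y in LHS]scale1r lcomb_linear scale1r scalerDr.
Qed.

Lemma pi_Amul d x y : cls d (hmul d x y) = Amul (cls d x) (cls d y).
Proof.
apply/esym/cls_eq; set x' := repr _; set y' := repr _.
have [[_ addI _] mulI] := perm_ideal_two_sided d.
have -> : hmul d x' y' - hmul d x y = hmul d x' (y' - y) + hmul d (x' - x) y.
  have E1 := hmulDr d x' (y' - y) y; have E2 := hmulDl d (x' - x) x y.
  by rewrite !subrK in E1 E2; rewrite E1 E2 addrA addrK.
by apply: addI; [case: (mulI x' _ (@repr_cls d y))
                |case: (mulI y _ (@repr_cls d x))].
Qed.

(* Main.v *)
Require Import Defs.
From HB Require Import structures.
From mathcomp Require Import all_boot all_order all_algebra.
From mathcomp Require Import finmap.
From mathcomp Require Import boolp classical_sets functions cardinality fsbigop.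
From mathcomp Require Import monalg.
From mathcomp Require Import mpoly.

(** Write x^u for the basis element u of the free algebra. The product of x^u
    and x^v is x^(u ++ v) multiplied by the kernel
    K(A, B) = prod_(s in B) prod_(t in A) (x_s - q x_t)^(d-1), where A and B are
    the sets of positions of u and of v in u ++ v. Multiplication by x_i adds 1
    to the i-th entry of a sequence, so it is an operator [varmul i] on the free
    module over all sequences, and multiplication by K is a composition
    [factors_mul] of commuting operators x_s - q x_t, indexed by a list of pairs
    of natural numbers. This form of the product ([hstarE]) does not mention
    the lengths of u and v in types.

    Associativity is the identity
    K(A, B ++ C) K(B, C) = K(A ++ B, C) K(A, B)
    between multisets of factors ([factors_cocycle]), since multiplication by
    x_i commutes with concatenation up to a shift of i ([hstarA], [hmulA]).

    For the quotient, let [sortop] be the linear map that sorts every basis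
    sequence. K(A, B) is symmetric in the positions of A and in those of B;
    hence permuting the entries of u and of v only permutes the positions in the
    terms of the product of u and v, and sorting erases this
    ([sortop_hstar_perm]). So the kernel of [sortop] is a two-sided ideal. It
    contains the differences of rearrangements and is spanned by them, because
    x - sortop x is such a combination; thus it is the ideal that defines the
    quotient ([perm_idealE]). Two elements therefore have the same class exactly
    when they have the same sorted form, and the remaining claims are read off
    sorted forms: sorted sequences of length n are a basis of the n-th component
    ([pcls_basis]), sorting preserves the length, which gives the grading
    ([Acomp_grading]), and the product formula is the one of the free algebra
    with each term replaced by its rearrangement ([Amul_pcls]). *)

Import GRing.Theory.

Local Open Scope classical_set_scope.
Local Open Scope ring_scope.

(** * Linear maps on the free module *)

HB.instance Definition _ (R : nzRingType) (I : choiceType) (V : lmodType R)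
    (e : I -> V) :=
  GRing.isLinear.Build R {malg R[I]} V _ (lcomb e) (lcomb_linear e).

Lemma lcomb_mkmalgU (I : choiceType) (V : lmodType Qq) (e : I -> V) i :
  lcomb e (monalg.mkmalgU i 1) = e i.
Proof.
rewrite (@lcombEw _ _ _ _ _ [fset i]%fset) ?msuppU_le //.
by rewrite big_seq_fset1 monalg.mcoeffU eqxx scale1r.
Qed.

Lemma lcombU (V : lmodType Qq) (e : seq nat -> V) u : lcomb e (hbasis u) = e u.
Proof. exact: lcomb_mkmalgU. Qed.

Lemma linear_lcomb (I : choiceType) (V W : lmodType Qq) (f : {linear V -> W}) (e : I -> V) x :
  f (lcomb e x) = lcomb (f \o e) x.
Proof. by rewrite linear_sum; apply: eq_bigr => i _; rewrite linearZ. Qed.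

Lemma mkmalgU_hbasis (a : Qq) u : monalg.mkmalgU u a = a *: hbasis u.
Proof.
by apply/monalg.malgP => k; rewrite monalg.mcoeffZ !monalg.mcoeffU mulr_natr.
Qed.

Lemma hcomp_ind n (P : hatA -> Prop) :
  P 0 -> (forall a u x, size u = n -> P x -> P (a *: hbasis u + x)) ->
  forall x, hcomp n x -> P x.
Proof.
move=> P0 PS x hx; rewrite [x]monalgE big_seq.
elim/big_rec: _ => // u y /hx su Py.
by rewrite mkmalgU_hbasis; exact: PS.
Qed.

Lemma hatA_ind (P : hatA -> Prop) :
  P 0 -> (forall a u x, P x -> P (a *: hbasis u + x)) -> forall x, P x.
Proof.
move=> P0 PS x; rewrite [x]monalgE.
elim/big_rec: _ => // u y _ Py.
by rewrite mkmalgU_hbasis; exact: PS.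
Qed.

Lemma hatA_ext (V : lmodType Qq) (f g : {linear hatA -> V}) :
  (forall u, f (hbasis u) = g (hbasis u)) -> f =1 g.
Proof.
move=> fg x; elim/hatA_ind: x => [|a u x IH]; first by rewrite !linear0.
by rewrite !linearP IH fg.
Qed.

Lemma hcomp_ext n (V : lmodType Qq) (f g : {linear hatA -> V}) :
  (forall u, size u = n -> f (hbasis u) = g (hbasis u)) ->
  forall x, hcomp n x -> f x = g x.
Proof.
move=> fg x; elim/hcomp_ind => [|a u {}x su IH]; first by rewrite !linear0.
by rewrite !linearP IH fg.
Qed.

Lemma hcomp_lin n a x y : hcomp n x -> hcomp n y -> hcomp n (a *: x + y).
Proof.
move=> hx hy u /(fsubsetP (monalg.msuppD_le _ _)); rewrite inE => /orP[|/hy//].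
by move=> /(fsubsetP (monalg.msuppZ_le _ _))/hx.
Qed.

Lemma hcomp0 n : hcomp n 0.
Proof. by move=> u; rewrite monalg.msupp0 inE. Qed.

Lemma hcompZ n a x : hcomp n x -> hcomp n (a *: x).
Proof. by move=> hx; rewrite -[_ *: _]addr0; apply: hcomp_lin => //; exact: hcomp0. Qed.

Lemma hcompD n x y : hcomp n x -> hcomp n y -> hcomp n (x + y).
Proof. by move=> hx hy; rewrite -[x]scale1r; apply: hcomp_lin. Qed.

Lemma hcompU u : hcomp (size u) (hbasis u).
Proof. by move=> v /(fsubsetP msuppU_le); rewrite inE => /eqP ->. Qed.

(** * Multiplication by linear factors *)

Definition varmul (i : nat) : hatA -> hatA :=
  lcomb (fun u => hbasis (incr_nth u i)).
HB.instance Definition _ i :=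
  GRing.isLinear.Build Qq hatA hatA _ (varmul i) (lcomb_linear _).

Lemma varmulU i u : varmul i (hbasis u) = hbasis (incr_nth u i).
Proof. exact: lcombU. Qed.

Definition factor_mul (p : nat * nat) (x : hatA) : hatA :=
  varmul p.1 x - ('X : Qq) *: varmul p.2 x.

Lemma factor_mul_linear p : linear (factor_mul p).
Proof.
by move=> a x y; rewrite /factor_mul !linearP /= scalerDr addrACA.
Qed.
HB.instance Definition _ p :=
  GRing.isLinear.Build Qq hatA hatA _ (factor_mul p) (factor_mul_linear p).

Definition factors_mul (l : seq (nat * nat)) (x : hatA) : hatA :=
  foldr factor_mul x l.

Lemma factors_mul_linear l : linear (factors_mul l).
Proof. by move=> a x y; elim: l => //= p l ->; rewrite linearP. Qed.
HB.instance Definition _ l :=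
  GRing.isLinear.Build Qq hatA hatA _ (factors_mul l) (factors_mul_linear l).

Lemma factors_mul_cat l1 l2 x :
  factors_mul (l1 ++ l2) x = factors_mul l1 (factors_mul l2 x).
Proof. exact: foldr_cat. Qed.

Lemma varmulC i j x : varmul i (varmul j x) = varmul j (varmul i x).
Proof.
apply: (hatA_ext _ (varmul i \o varmul j) (varmul j \o varmul i)) => u /=.
by rewrite !varmulU incr_nthC.
Qed.

Lemma factor_mulC p r x :
  factor_mul p (factor_mul r x) = factor_mul r (factor_mul p x).
Proof.
have vB i y z : varmul i (y - ('X : Qq) *: z) = varmul i y - ('X : Qq) *: varmul i z.
  by rewrite ![_ - _]addrC -!scaleNr linearP.
have swap (V : lmodType Qq) (c : Qq) (w y z t : V) :
    w - c *: y - c *: (z - c *: t) = w - c *: z - c *: (y - c *: t).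
  by rewrite !scalerBr !opprD !addrA (addrAC w).
rewrite /factor_mul !vB (varmulC r.1 p.1) (varmulC r.1 p.2).
by rewrite (varmulC r.2 p.1) (varmulC r.2 p.2); exact: swap.
Qed.

Lemma factor_mulE p x : factor_mul p x = varmul p.1 x - ('X : Qq) *: varmul p.2 x.
Proof. by []. Qed.

Opaque varmul factor_mul.

Lemma perm_foldr_commute (T : eqType) (S : Type) (f : T -> S -> S) l1 l2 x :
  (forall p r y, f p (f r y) = f r (f p y)) ->
  perm_eq l1 l2 -> foldr f x l1 = foldr f x l2.
Proof.
move=> fC; elim: l1 l2 => [|p l1 IH] l2; first by rewrite perm_sym => /perm_nilP ->.
move=> pl; have pl2 : p \in l2 by rewrite -(perm_mem pl) mem_head.
rewrite /= (IH (rem p l2)); last first.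
  by rewrite -(perm_cons p) (perm_trans pl) // perm_to_rem.
elim: l2 pl2 {pl} => //= r l2 IH2; rewrite inE eq_sym.
by have [->|_ /= /IH2 <-] := eqVneq r p; rewrite 1?fC.
Qed.

Lemma factors_mul_perm l1 l2 x :
  perm_eq l1 l2 -> factors_mul l1 x = factors_mul l2 x.
Proof. by move=> pl; apply: perm_foldr_commute pl; exact: factor_mulC. Qed.

(** The factors of K(A, B) with d - 1 = e, each pair (s, t) standing for
    x_s - q x_t; each is repeated e times, so that identities between kernels
    become equalities of multisets of pairs. *)
Definition factors (e : nat) (A B : seq nat) : seq (nat * nat) :=
  flatten (nseq e [seq (s, t) | s <- B, t <- A]).

Lemma hcomp_varmul n i x : (i < n)%N -> hcomp n x -> hcomp n (varmul i x).
Proof.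
move=> lin; elim/hcomp_ind=> [|a u {}x su IH]; first by rewrite linear0; exact: hcomp0.
rewrite linearP /= varmulU; apply: hcomp_lin => //.
have -> : n = size (incr_nth u i) by rewrite size_incr_nth su lin.
exact: hcompU.
Qed.

Definition factors_lt n := all (fun p : nat * nat => (p.1 < n)%N && (p.2 < n)%N).

Lemma hcomp_factors_mul n l x :
  factors_lt n l -> hcomp n x -> hcomp n (factors_mul l x).
Proof.
elim: l => //= p l IH /andP[/andP[p1 p2] pl] hx; have {IH}hl := IH pl hx.
rewrite factor_mulE addrC -scaleNr; apply: hcomp_lin; exact: hcomp_varmul.
Qed.

Lemma factors_ltP e n A B : all (fun i => (i < n)%N) A -> all (fun i => (i < n)%N) B ->
  factors_lt n (factors e A B).
Proof.
move=> /allP hA /allP hB; apply/allP => p /flattenP[l].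
rewrite mem_nseq => /andP[_ /eqP ->] /allpairsP[[s t] /= [sB tA ->]] /=.
by rewrite (hB s) ?(hA t).
Qed.

(** * From polynomials to operators *)

Section PolyExt.
Context {n : nat} {V : lmodType Qq}.
Implicit Type G : 'X_{1.. n} -> V.

(** The linear extension to polynomials of a family indexed by monomials; the
    sum over all monomials has finite support. *)
Definition mpoly_lcomb G (p : mpoly.mpoly n Qq) : V :=
  \sum_(k \in [set: 'X_{1.. n}]) mpoly.mcoeff k p *: G k.

Lemma mpoly_lcombE G p (D : {fset 'X_{1.. n}}) :
  {subset mpoly.msupp p <= D} ->
  mpoly_lcomb G p = \sum_(k <- D) mpoly.mcoeff k p *: G k.
Proof.
move=> sD; apply: fsbigTE => k kD; rewrite memN_msupp_eq0 ?scale0r //.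
by apply: contra kD; exact: sD.
Qed.

Lemma mpoly_lcomb_linear G : linear (mpoly_lcomb G).
Proof.
move=> a p q.
pose D := [fset k | k in mpoly.msupp p ++ mpoly.msupp q ++ mpoly.msupp (a *: p + q)]%fset.
rewrite !(@mpoly_lcombE _ _ D); try by move=> k kp; rewrite !inE /= ?mem_cat kp ?orbT.
rewrite scaler_sumr -big_split; apply: eq_bigr => k _ /=.
by rewrite mpoly.mcoeffD mpoly.mcoeffZ scalerDl scalerA.
Qed.

HB.instance Definition _ G :=
  GRing.isLinear.Build Qq (mpoly.mpoly n Qq) V _ (mpoly_lcomb G) (mpoly_lcomb_linear G).

Lemma mpoly_lcombX G k : mpoly_lcomb G (mpolyX _ k) = G k.
Proof.
rewrite (@mpoly_lcombE _ _ [fset k]%fset); last first.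
  by move=> k'; rewrite msuppX !inE.
by rewrite big_seq_fset1 mpoly.mcoeffX eqxx scale1r.
Qed.

End PolyExt.

Lemma linear_mpoly_lcomb n (V W : lmodType Qq) (f : {linear V -> W})
    (G : 'X_{1.. n} -> V) p : f (mpoly_lcomb G p) = mpoly_lcomb (f \o G) p.
Proof.
rewrite !(@mpoly_lcombE _ _ _ _ [fset k | k in mpoly.msupp p]%fset);
  try by move=> k; rewrite !inE.
by rewrite linear_sum; apply: eq_bigr => k _; rewrite linearZ.
Qed.

Definition nats_of_ord_pairs {n} (l : seq ('I_n * 'I_n)) : seq (nat * nat) :=
  [seq (val p.1, val p.2) | p <- l].

Lemma tadd_mnmU n (w : n.-tuple nat) (i : 'I_n) (k : 'X_{1.. n}) :
  tadd w (U_(i) + k)%MM = incr_nth (tadd w k) i :> seq nat.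
Proof.
apply: (@eq_from_nth _ 0%N).
  by rewrite size_incr_nth !size_tuple ltn_ord.
move=> j; rewrite size_tuple => jn.
rewrite nth_incr_nth -[j]/(val (Ordinal jn)) -!tnth_nth !tnth_mktuple.
by rewrite mnm1E -mnm_tnth addnCA.
Qed.

Lemma tadd_mnm0 n (w : n.-tuple nat) : tadd w (0%MM : 'X_{1.. n}) = w.
Proof.
by apply/eq_from_tnth => i; rewrite tnth_mktuple -mnm_tnth mnm0E addn0.
Qed.

(** Sending the monomial x^k to the basis element w + k turns multiplication by
    x_i into [varmul i], hence a product of linear factors into the composition
    of the corresponding operators. *)
Lemma mpoly_lcomb_factors n (w : n.-tuple nat) (l : seq ('I_n * 'I_n)) :
  mpoly_lcomb (fun k : 'X_{1.. n} => hbasis (tadd w k))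
    (\prod_(p <- l) ('X_(p.1) - ('X : Qq) *: 'X_(p.2))) =
  factors_mul (nats_of_ord_pairs l) (hbasis w).
Proof.
set G := fun k => _.
have GX i p : mpoly_lcomb G ('X_i * p) = varmul i (mpoly_lcomb G p).
  elim/mpolyind: p => [|c k p _ _ IH]; first by rewrite mulr0 !linear0.
  rewrite mulrDr -scalerAr -mpolyXD !linearP /= IH !mpoly_lcombX varmulU.
  by rewrite /G tadd_mnmU.
elim: l => [|p l IH] /=.
  by rewrite big_nil -mpolyX0 mpoly_lcombX /G tadd_mnm0.
rewrite big_cons mulrBl -scalerAl factor_mulE -IH /=.
by rewrite -!GX addrC -scaleNr linearP /= scaleNr addrC.
Qed.

(** * Identities between kernels *)

Lemma count_factors e A B (P : pred (nat * nat)) :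
  count P (factors e A B) = ((\sum_(s <- B) \sum_(t <- A) P (s, t)) * e)%N.
Proof.
rewrite count_flatten map_nseq sumn_nseq; congr (_ * _)%N.
rewrite -sum1_count big_mkcond big_allpairs.
by apply: eq_bigr => s _; apply: eq_bigr => t _; case: (P _).
Qed.

Lemma perm_factors e A A' B B' :
  perm_eq A A' -> perm_eq B B' -> perm_eq (factors e A B) (factors e A' B').
Proof.
move=> pA pB; apply/permP => P; rewrite !count_factors; congr (_ * _)%N.
by rewrite (perm_big _ pB); apply: eq_bigr => s _; rewrite (perm_big _ pA).
Qed.

(** Both sides are the pairs that join two different blocks among A, B and C;
    this is why the product is associative. *)
Lemma factors_cocycle e A B C :
  perm_eq (factors e A (B ++ C) ++ factors e B C)
          (factors e (A ++ B) C ++ factors e A B).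
Proof.
apply/permP => P; rewrite !count_cat !count_factors -!mulnDl; congr (_ * _)%N.
rewrite big_cat /=; under [in RHS]eq_bigr => s _ do rewrite big_cat.
by rewrite big_split -addnA addnC.
Qed.

Lemma map_factors (f : nat -> nat) e A B :
  [seq (f p.1, f p.2) | p <- factors e A B] = factors e (map f A) (map f B).
Proof.
rewrite /factors map_flatten map_nseq map_allpairs /=.
by rewrite allpairs_mapl; congr (flatten (nseq _ _)); rewrite allpairs_mapr.
Qed.

Lemma factors_nill e B : factors e [::] B = [::].
Proof. by rewrite /factors (_ : [seq _ | s <- B, t <- [::]] = [::]); [elim: e | elim: B]. Qed.

Lemma factors_nilr e A : factors e A [::] = [::].
Proof. by rewrite /factors; elim: e. Qed.

(** * The product of two basis elements *)

Lemma cpolyE d m n :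
  cpoly d m n =
  \prod_(p <- flatten (nseq d.-1 [seq (rshift m s, lshift n t) | s <- enum 'I_n, t <- enum 'I_m]))
    ('X_(p.1) - ('X : Qq) *: 'X_(p.2)).
Proof.
rewrite big_flatten big_nseq big_allpairs_dep big_enum /cpoly /=.
under eq_bigr => s _ do rewrite prodrXl.
under [in RHS]eq_bigr => s _ do rewrite big_enum.
by rewrite prodrXl; elim: (d.-1) => // e /= <-; rewrite exprS.
Qed.

Lemma nats_of_cpoly_factors e m n :
  nats_of_ord_pairs (flatten (nseq e
    [seq (rshift m s, lshift n t) | s <- enum 'I_n, t <- enum 'I_m])) =
  factors e (iota 0 m) (iota m n).
Proof.
rewrite /nats_of_ord_pairs map_flatten map_nseq map_allpairs /=.
have -> : iota m n = [seq (m + val s)%N | s <- enum 'I_n].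
  by rewrite -[in LHS](addn0 m) iotaDl -val_enum_ord -map_comp.
by rewrite /factors -[iota 0 m]val_enum_ord allpairs_mapl allpairs_mapr.
Qed.

Section Split.
Context {m n : nat}.

Definition mnm_cat (ab : m.-tuple nat * n.-tuple nat) : 'X_{1.. m + n} :=
  Multinom [tuple of ab.1 ++ ab.2].
Definition mnm_split (k : 'X_{1.. m + n}) : m.-tuple nat * n.-tuple nat :=
  ([tuple k (lshift n i) | i < m], [tuple k (rshift m j) | j < n]).

Lemma mnm_catK : cancel mnm_cat mnm_split.
Proof.
move=> [a b]; congr (_, _); apply: eq_from_tnth => i; rewrite tnth_mktuple mnm_tnth.
  by rewrite tnth_lshift.
by rewrite tnth_rshift.
Qed.

Lemma mnm_splitK : cancel mnm_split mnm_cat.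
Proof.
move=> k; apply/mnmP => i; rewrite mnm_tnth; case: (split_ordP i) => j ->.
  by rewrite tnth_lshift tnth_mktuple.
by rewrite tnth_rshift tnth_mktuple.
Qed.

Lemma tadd_split (u : m.-tuple nat) (v : n.-tuple nat) (k : 'X_{1.. m + n}) :
  tadd u (mnm_split k).1 ++ tadd v (mnm_split k).2 = tadd [tuple of u ++ v] k :> seq nat.
Proof.
rewrite -[LHS]/(val [tuple of _ ++ _]); congr val; apply: eq_from_tnth => i.
rewrite tnth_mktuple; case: (split_ordP i) => j ->.
  by rewrite !tnth_lshift !tnth_mktuple mnm_tnth.
by rewrite !tnth_rshift !tnth_mktuple mnm_tnth.
Qed.

(** The exponents of a monomial in m + n variables are the concatenation of a
    pair (a, b), so a sum weighted by the coefficients c^(a,b) is the linear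
    extension evaluated at the polynomial that defines them. *)
Lemma ccoef_fsum d (V : lmodType Qq) (F : m.-tuple nat * n.-tuple nat -> V) :
  \sum_(ab \in [set: m.-tuple nat * n.-tuple nat]) ccoef d ab.1 ab.2 *: F ab =
  mpoly_lcomb (F \o mnm_split) (cpoly d m n).
Proof.
rewrite /mpoly_lcomb (reindex_fsbigT mnm_cat); last first.
  by exists mnm_split; [exact: mnm_catK | exact: mnm_splitK].
by apply: eq_fsbigr => ab _ /=; rewrite mnm_catK.
Qed.

End Split.

Lemma ccoef_hbasis d m n (u : m.-tuple nat) (v : n.-tuple nat) :
  \sum_(ab \in [set: m.-tuple nat * n.-tuple nat])
    ccoef d ab.1 ab.2 *: hbasis (tadd u ab.1 ++ tadd v ab.2) =
  factors_mul (factors d.-1 (iota 0 m) (iota m n)) (hbasis (u ++ v)).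
Proof.
rewrite (ccoef_fsum d _ (fun ab => hbasis (tadd u ab.1 ++ tadd v ab.2))) cpolyE.
have -> : (fun ab => hbasis (tadd u ab.1 ++ tadd v ab.2)) \o mnm_split =
          (fun k : 'X_{1.. m + n} => hbasis (tadd [tuple of u ++ v] k)).
  by apply/funext => k /=; rewrite tadd_split.
by rewrite mpoly_lcomb_factors nats_of_cpoly_factors.
Qed.

(** The formula also holds when u or v is empty: the list of factors is then
    empty, in accordance with the separate clauses for the unit. *)
Lemma hstarE d u v :
  hstar d u v =
  factors_mul (factors d.-1 (iota 0 (size u)) (iota (size u) (size v))) (hbasis (u ++ v)).
Proof.
case: u => [|i u]; first by rewrite factors_nill.
case: v => [|j v]; first by rewrite factors_nilr cats0.
exact: (ccoef_hbasis d _ _ (in_tuple (i :: u)) (in_tuple (j :: v))).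
Qed.

(** * Associativity and unit of the free algebra *)

Lemma hmul_linearr d x : linear (hmul d x).
Proof.
move=> a y y'; rewrite hmulDr; congr (_ + _); rewrite /hmul /lcomb scaler_sumr.
apply: eq_bigr => u _; rewrite scalerA mulrC -scalerA -!/(lcomb _ _); congr (_ *: _).
exact: linearZ.
Qed.

HB.instance Definition _ d x :=
  GRing.isLinear.Build Qq hatA hatA _ (hmul d x) (hmul_linearr d x).

(** Left multiplicands as the variable, to have a linear map in each argument. *)
Definition hmull d y x := hmul d x y.

Lemma hmullE d y x : hmull d y x = hmul d x y.
Proof. by []. Qed.

Lemma hmull_linear d y : linear (hmull d y).
Proof. exact: lcomb_linear. Qed.

HB.instance Definition _ d y :=
  GRing.isLinear.Build Qq hatA hatA _ (hmull d y) (hmull_linear d y).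

Lemma hmul_hbasis d u v : hmul d (hbasis u) (hbasis v) = hstar d u v.
Proof. by rewrite /hmul !lcombU. Qed.

Definition catr (w : seq nat) : hatA -> hatA := lcomb (fun u => hbasis (u ++ w)).
HB.instance Definition _ w :=
  GRing.isLinear.Build Qq hatA hatA _ (catr w) (lcomb_linear _).
Definition catl (w : seq nat) : hatA -> hatA := lcomb (fun v => hbasis (w ++ v)).
HB.instance Definition _ w :=
  GRing.isLinear.Build Qq hatA hatA _ (catl w) (lcomb_linear _).

Lemma catrU w u : catr w (hbasis u) = hbasis (u ++ w).
Proof. exact: lcombU. Qed.
Lemma catlU w v : catl w (hbasis v) = hbasis (w ++ v).
Proof. exact: lcombU. Qed.

Opaque catl catr hmul.

Lemma incr_nth_catl (u w : seq nat) i : (i < size u)%N -> incr_nth (u ++ w) i = incr_nth u i ++ w.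
Proof. by elim: u i => [|a u IH] [|i] //= iu; rewrite IH. Qed.

Lemma incr_nth_catr (u w : seq nat) i : incr_nth (u ++ w) (size u + i) = u ++ incr_nth w i.
Proof. by elim: u => //= a u ->. Qed.

Lemma factor_mul_hbasis p u : factor_mul p (hbasis u) =
  hbasis (incr_nth u p.1) - ('X : Qq) *: hbasis (incr_nth u p.2).
Proof. by rewrite factor_mulE !varmulU. Qed.

(** The positions of u keep their index in u ++ w; the bound on the length of
    the terms of x matters because [incr_nth] pads a sequence that is too
    short. *)
Lemma catr_factors_mul w n l x : factors_lt n l -> hcomp n x ->
  catr w (factors_mul l x) = factors_mul l (catr w x).
Proof.
move=> + hx; elim: l => //= p l IH /andP[/andP[p1 p2] pl].
rewrite -(IH pl); move: (factors_mul l x) (hcomp_factors_mul n l x pl hx).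
apply: (hcomp_ext _ _ (catr w \o factor_mul p) (factor_mul p \o catr w)) => u su /=.
rewrite catrU !factor_mul_hbasis ![_ - _]addrC -!scaleNr linearP /= !catrU.
by rewrite -!incr_nth_catl ?su.
Qed.

(** The position i of v is the position size w + i of w ++ v. *)
Lemma catl_factors_mul w l y :
  catl w (factors_mul l y) =
  factors_mul [seq (size w + p.1, size w + p.2)%N | p <- l] (catl w y).
Proof.
elim: l => //= p l <-; move: (factors_mul l y).
set p' := (_, _).
apply: (hatA_ext _ (catl w \o factor_mul p) (factor_mul p' \o catl w)) => u /=.
by rewrite catlU !factor_mul_hbasis ![_ - _]addrC -!scaleNr linearP /= !catlU -!incr_nth_catr.
Qed.

Lemma hmul_hbasisr d m x w : hcomp m x ->
  hmul d x (hbasis w) =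
  factors_mul (factors d.-1 (iota 0 m) (iota m (size w))) (catr w x).
Proof.
set l := factors _ _ _ => hx.
apply: (hcomp_ext _ _ (hmull d (hbasis w))
                      (factors_mul l \o catr w) _ _ hx) => u su /=.
by rewrite hmullE hmul_hbasis catrU hstarE su.
Qed.

Lemma hmul_hbasisl d n u y : hcomp n y ->
  hmul d (hbasis u) y =
  factors_mul (factors d.-1 (iota 0 (size u)) (iota (size u) n)) (catl u y).
Proof.
set l := factors _ _ _ => hy.
apply: (hcomp_ext _ _ (hmul d (hbasis u)) (factors_mul l \o catl u) _ _ hy) => v sv /=.
by rewrite hmul_hbasis catlU hstarE sv.
Qed.

Lemma factors_iota_lt e m n :
  factors_lt (m + n) (factors e (iota 0 m) (iota m n)).
Proof.
apply: factors_ltP; apply/allP => i; rewrite mem_iota ?add0n; last by case/andP.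
by move=> /andP[_ im]; rewrite ltn_addr.
Qed.

Lemma hcomp_hstar d u v : hcomp (size u + size v) (hstar d u v).
Proof.
rewrite hstarE; apply: hcomp_factors_mul; first exact: factors_iota_lt.
by rewrite -size_cat; exact: hcompU.
Qed.

(** Both products are x^(u ++ v ++ w) times the two kernels of
    [factors_cocycle]. *)
Lemma hstarA d u v w :
  hmul d (hbasis u) (hstar d v w) = hmul d (hstar d u v) (hbasis w).
Proof.
rewrite (hmul_hbasisl _ _ _ _ (hcomp_hstar d v w)).
rewrite (hmul_hbasisr _ _ _ _ (hcomp_hstar d u v)).
have huv : hcomp (size u + size v) (hbasis (u ++ v)) by rewrite -size_cat; exact: hcompU.
rewrite !hstarE (catr_factors_mul _ _ _ _ (factors_iota_lt _ _ _) huv).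
rewrite catl_factors_mul (map_factors (addn (size u))) -!iotaDl addn0.
rewrite catlU catrU catA -!factors_mul_cat.
apply: factors_mul_perm; rewrite !iotaD add0n; exact: factors_cocycle.
Qed.

Lemma hmulA d : associative (hmul d).
Proof.
move=> x y z.
apply: (hatA_ext _ (hmull d (hmul d y z)) (hmull d z \o hmull d y)) => u {x}; rewrite /= !hmullE.
apply: (hatA_ext _ (hmul d (hbasis u) \o hmull d z)
                   (hmull d z \o hmul d (hbasis u))) => v {y}; rewrite /= !hmullE.
apply: (hatA_ext _ (hmul d (hbasis u) \o hmul d (hbasis v))
                   (hmul d (hmul d (hbasis u) (hbasis v)))) => w {z} /=.
by rewrite !hmul_hbasis hstarA.
Qed.

Lemma hmul1l d : left_id (hbasis [::]) (hmul d).
Proof.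
by apply: (hatA_ext _ (hmul d (hbasis [::])) idfun) => u /=; rewrite hmul_hbasis.
Qed.

Lemma hmul1r d : right_id (hbasis [::]) (hmul d).
Proof.
apply: (hatA_ext _ (hmull d (hbasis [::])) idfun) => u.
by rewrite /= hmullE hmul_hbasis; case: u.
Qed.

Lemma hcomp_hmul d m n x y : hcomp m x -> hcomp n y -> hcomp (m + n) (hmul d x y).
Proof.
move=> hx hy; elim/hcomp_ind: hx => [|a u {}x su IH].
  by rewrite -hmullE (linear0 (hmull d y)); exact: hcomp0.
rewrite -hmullE (linearP (hmull d y)); apply: hcomp_lin => // {x IH}.
elim/hcomp_ind: hy => [|b v {}y sv IH].
  by rewrite /= hmullE (linear0 (hmul d _)); exact: hcomp0.
rewrite /= hmullE (linearP (hmul d _)) /= hmul_hbasis; apply: hcomp_lin => //.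
by rewrite -su -sv; exact: hcomp_hstar.
Qed.

(** * Sorting and the permutation ideal *)

Definition reindex (Is : seq nat) : hatA -> hatA :=
  lcomb (fun w => hbasis [seq nth 0%N w i | i <- Is]).
HB.instance Definition _ Is :=
  GRing.isLinear.Build Qq hatA hatA _ (reindex Is) (lcomb_linear _).

Lemma reindexU Is w : reindex Is (hbasis w) = hbasis [seq nth 0%N w i | i <- Is].
Proof. exact: lcombU. Qed.

Definition sortop : hatA -> hatA := lcomb (fun u => hbasis (sort leq u)).
HB.instance Definition _ :=
  GRing.isLinear.Build Qq hatA hatA _ sortop (lcomb_linear _).

Lemma sortopU u : sortop (hbasis u) = hbasis (sort leq u).
Proof. exact: lcombU. Qed.

Opaque reindex sortop.

(** Entry j of w moves to the place where j occurs in Is, so reindexing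
    conjugates multiplication by x_j to multiplication by x_(index j Is). *)
Lemma map_nth_incr_nth Is w j : uniq Is -> j \in Is ->
  [seq nth 0%N (incr_nth w j) i | i <- Is] =
  incr_nth [seq nth 0%N w i | i <- Is] (index j Is).
Proof.
move=> uIs jIs; have lj : (index j Is < size Is)%N by rewrite index_mem.
apply: (@eq_from_nth _ 0%N); first by rewrite size_incr_nth !size_map lj.
move=> i; rewrite size_map => li.
rewrite nth_incr_nth !(nth_map 0%N) // nth_incr_nth -{1}(nth_index 0%N jIs).
by rewrite nth_uniq.
Qed.

Lemma reindex_factors_mul Is l x : uniq Is ->
  all (fun p => (p.1 \in Is) && (p.2 \in Is)) l ->
  reindex Is (factors_mul l x) =
  factors_mul [seq (index p.1 Is, index p.2 Is) | p <- l] (reindex Is x).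
Proof.
move=> uIs; elim: l => //= p l IH /andP[/andP[p1 p2] pl].
rewrite -(IH pl); move: (factors_mul l x); set p' := (_, _).
apply: (hatA_ext _ (reindex Is \o factor_mul p) (factor_mul p' \o reindex Is)) => w /=.
rewrite reindexU !factor_mul_hbasis ![_ - _]addrC -!scaleNr linearP /= !reindexU.
by rewrite !map_nth_incr_nth.
Qed.

Lemma sort_perm (u v : seq nat) : perm_eq u v -> sort leq u = sort leq v.
Proof. by move/(perm_sortP leq_total leq_trans anti_leq). Qed.

Lemma perm_map_nth Is (w : seq nat) : perm_eq Is (iota 0 (size w)) ->
  perm_eq [seq nth 0%N w i | i <- Is] w.
Proof. by move=> pI; apply/(perm_iotaP 0%N); exists Is. Qed.

Lemma sortop_reindex N Is x : perm_eq Is (iota 0 N) -> hcomp N x ->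
  sortop (reindex Is x) = sortop x.
Proof.
move=> pI; apply: (hcomp_ext _ _ (sortop \o reindex Is) sortop) => w sw /=.
by rewrite reindexU !sortopU (sort_perm _ _ (perm_map_nth _ _ _)) ?sw.
Qed.

Lemma map_index_id (Is : seq nat) : uniq Is -> [seq index i Is | i <- Is] = iota 0 (size Is).
Proof.
move=> uI; apply: (@eq_from_nth _ 0%N); rewrite ?size_iota ?size_map // => i li.
by rewrite (nth_map 0%N) // index_uniq // nth_iota.
Qed.

(** A rearrangement of u and one of v combine to a permutation Ks of the
    positions of u ++ v that preserves both blocks. The kernel is symmetric in
    each block, so the two products differ by the reindexing along Ks, which
    sorting does not see. *)
Lemma sortop_hstar_perm d u v u' v' : perm_eq u' u -> perm_eq v' v ->
  sortop (hstar d u' v') = sortop (hstar d u v).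
Proof.
move=> /(perm_iotaP 0%N)[Is pI ->] /(perm_iotaP 0%N)[Js pJ ->].
set m := size u in pI *; set n := size v in pJ *.
have sI : size Is = m by rewrite (perm_size pI) size_iota.
have sJ : size Js = n by rewrite (perm_size pJ) size_iota.
pose Js' := map (addn m) Js; pose Ks := Is ++ Js'.
have pJ' : perm_eq Js' (iota m n) by rewrite -[m in iota m n]addn0 iotaDl perm_map.
have pK : perm_eq Ks (iota 0 (m + n)) by rewrite iotaD perm_cat.
have uK : uniq Ks by rewrite (perm_uniq pK) iota_uniq.
have -> : hstar d [seq nth 0%N u i | i <- Is] [seq nth 0%N v i | i <- Js] =
          reindex Ks (hstar d u v).
  rewrite !hstarE !size_map sI sJ reindex_factors_mul //; last first.
    apply/allP => p /(allP (factors_iota_lt _ _ _)).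
    by rewrite !(perm_mem pK) !mem_iota.
  rewrite (map_factors (index^~ Ks)) reindexU map_cat.
  have -> : [seq nth 0%N (u ++ v) i | i <- Is] = [seq nth 0%N u i | i <- Is].
    apply/eq_in_map => i; rewrite (perm_mem pI) mem_iota => /= iu.
    by rewrite nth_cat iu.
  have -> : [seq nth 0%N (u ++ v) i | i <- Js'] = [seq nth 0%N v i | i <- Js].
    by rewrite -map_comp; apply: eq_map => j /=; rewrite nth_cat ltnNge leq_addr addKn.
  have iK : [seq index i Ks | i <- Is] ++ [seq index i Ks | i <- Js'] = iota 0 m ++ iota m n.
    by rewrite -map_cat map_index_id // (perm_size pK) size_iota iotaD.
  have [iI iJ] : [seq index i Ks | i <- Is] = iota 0 m /\ [seq index i Ks | i <- Js'] = iota m n.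
    by move/eqP: iK; rewrite eqseq_cat ?size_map ?size_iota // => /andP[/eqP-> /eqP->].
  apply: factors_mul_perm; apply: perm_factors.
    by rewrite -[X in perm_eq X _]iI perm_map.
  by rewrite -[X in perm_eq X _]iJ perm_map.
exact: (sortop_reindex _ _ _ pK (hcomp_hstar d u v)).
Qed.

(** Consequently the sorted form of a product depends only on the sorted forms
    of its factors, so the kernel of [sortop] is a two-sided ideal. *)
Lemma sortop_hmul d x y : sortop (hmul d (sortop x) (sortop y)) = sortop (hmul d x y).
Proof.
apply: (hatA_ext _ (sortop \o hmull d (sortop y) \o sortop) (sortop \o hmull d y)) => u {x}.
rewrite /= !hmullE.
apply: (hatA_ext _ (sortop \o hmul d (sortop (hbasis u)) \o sortop)
                   (sortop \o hmul d (hbasis u))) => v {y} /=.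
rewrite !sortopU !hmul_hbasis; apply: sortop_hstar_perm; exact/permPl/perm_sort.
Qed.

Lemma sortopK x : sortop (sortop x) = sortop x.
Proof.
apply: (hatA_ext _ (sortop \o sortop) sortop) => u /=.
by rewrite !sortopU (sorted_sort leq_trans) ?(sort_sorted leq_total).
Qed.

Lemma perm_ideal_hbasis d u v : perm_eq u v -> perm_ideal d (hbasis u - hbasis v).
Proof. by move=> uv J [_ dJ]; apply: dJ; exists u, v. Qed.

Lemma perm_ideal_sortop d x : perm_ideal d (x - sortop x).
Proof.
have [[I0 ID IZ] _] := perm_ideal_two_sided d.
elim/hatA_ind: x => [|a u x IH]; first by rewrite (linear0 sortop) subrr.
rewrite (linearP sortop) /= sortopU opprD addrACA -scalerBr; apply: ID => //.
by apply: IZ; apply: perm_ideal_hbasis; rewrite perm_sym; exact/permPl/perm_sort.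
Qed.

(** The kernel of [sortop] is a two-sided ideal containing the differences, so
    it contains the ideal they generate; conversely x is congruent to its sorted
    form modulo this ideal. *)
Lemma perm_idealE d x : perm_ideal d x <-> sortop x = 0.
Proof.
split=> [Ix|x0]; last by have := perm_ideal_sortop d x; rewrite x0 subr0.
apply: (Ix [set y | sortop y = 0]); split; last first.
  by move=> y /= [u [v [uv ->]]]; rewrite (linearB sortop) /= !sortopU (sort_perm _ _ uv) subrr.
split; first split=> [|y z y0 z0|a y y0] /=.
- exact: (linear0 sortop).
- by rewrite (linearD sortop) /= y0 z0 addr0.
- by rewrite (linearZ_LR sortop) /= y0 scaler0.
move=> y z /= z0; split; rewrite -sortop_hmul z0.
  by rewrite (linear0 (hmul d _)) (linear0 sortop).
by rewrite -hmullE (linear0 (hmull d _)) (linear0 sortop).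
Qed.

(** * The quotient algebra *)

Lemma cls_linear d : linear (cls d).
Proof. by move=> a x y; rewrite clsD pi_Ascale. Qed.
HB.instance Definition _ d :=
  GRing.isLinear.Build Qq hatA (Aq d) _ (cls d) (cls_linear d).

Lemma cls_eqP d x y : cls d x = cls d y <-> sortop x = sortop y.
Proof.
rewrite cls_eq perm_idealE (linearB sortop) /=; split=> [/eqP|->]; last by rewrite subrr.
by rewrite subr_eq0 => /eqP.
Qed.

Lemma cls_sortop d x : cls d (sortop x) = cls d x.
Proof. by apply/cls_eqP; exact: sortopK. Qed.

Lemma cls_hbasis_sorted d n (t : n.-tuple nat) : cls d (hbasis t) = pcls d (incr_rearr t).
Proof. by apply/cls_eqP; rewrite -sortopK !sortopU. Qed.

Definition homog_part (n : nat) : hatA -> hatA :=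
  lcomb (fun u => if size u == n then hbasis u else 0).
HB.instance Definition _ n :=
  GRing.isLinear.Build Qq hatA hatA _ (homog_part n) (lcomb_linear _).

Lemma homog_partU n u : homog_part n (hbasis u) = if size u == n then hbasis u else 0.
Proof. exact: lcombU. Qed.

Opaque homog_part cls.

Lemma hcomp_homog_part n x : hcomp n (homog_part n x).
Proof.
elim/hatA_ind: x => [|a u x IH]; first by rewrite (linear0 (homog_part n)); exact: hcomp0.
rewrite (linearP (homog_part n)) /=; apply: hcomp_lin => //; rewrite homog_partU.
by case: eqP => [<-|_]; [exact: hcompU | exact: hcomp0].
Qed.

Lemma homog_part_hcomp m n x : hcomp m x -> homog_part n x = if m == n then x else 0.
Proof.
case: eqP => [<-|/eqP mn].
  by apply: (hcomp_ext _ _ (homog_part m) idfun) => u su /=; rewrite homog_partU su eqxx.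
by apply: (hcomp_ext _ _ (homog_part n) \0) => u su /=; rewrite homog_partU su (negPf mn).
Qed.

Lemma sum_homog_parts x : exists n, x = \sum_(i < n) homog_part i x.
Proof.
(* The number of terms must be free to grow when another term is added to x. *)
suff [n xn] : exists n, forall N, (n <= N)%N -> x = \sum_(i < N) homog_part i x.
  by exists n; exact: xn.
elim/hatA_ind: x => [|a u x [n xn]].
  by exists 0%N => N _; rewrite big1 // => i _; rewrite (linear0 (homog_part i)).
exists (maxn (size u).+1 n) => N; rewrite geq_max => /andP[uN nN].
under eq_bigr => i _ do rewrite (linearP (homog_part i)).
have uE : \sum_(i < N) homog_part i (hbasis u) = hbasis u.
  rewrite (bigD1 (Ordinal uN)) //= homog_partU eqxx big1 ?addr0 // => i iu.
  by rewrite homog_partU; case: eqP => // su; case/eqP: iu; exact: val_inj.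
by rewrite big_split /= -scaler_sumr uE -(xn N nN).
Qed.

Lemma hcomp_sortop n x : hcomp n x -> hcomp n (sortop x).
Proof.
elim/hcomp_ind => [|a u {}x su IH]; first by rewrite (linear0 sortop); exact: hcomp0.
rewrite (linearP sortop) /= sortopU; apply: hcomp_lin => //.
by rewrite -su -(size_sort leq); exact: hcompU.
Qed.

Lemma Amul_cls d x y : Amul (cls d x) (cls d y) = cls d (hmul d x y).
Proof. by rewrite pi_Amul. Qed.

Lemma cls_surj d (x : Aq d) : exists y, x = cls d y.
Proof. by exists (repr x); rewrite cls_repr. Qed.

Lemma Amul_assoc_unital d : is_assoc_unital_algebra (@Amul d) (Aone d).
Proof.
split; first split.
- move=> x y z; have [[[x' ->] [y' ->]] [z' ->]] := (cls_surj d x, cls_surj d y, cls_surj d z).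
  by rewrite -clsD !Amul_cls hmulDl clsD.
- move=> x y z; have [[[x' ->] [y' ->]] [z' ->]] := (cls_surj d x, cls_surj d y, cls_surj d z).
  by rewrite -clsD !Amul_cls hmulDr clsD.
- move=> a x y; have [[x' ->] [y' ->]] := (cls_surj d x, cls_surj d y).
  rewrite -(linearZ_LR (cls d)) /= !Amul_cls -(linearZ_LR (cls d)) /=.
  by rewrite -!hmullE (linearZ_LR (hmull d _)).
- move=> a x y; have [[x' ->] [y' ->]] := (cls_surj d x, cls_surj d y).
  rewrite -(linearZ_LR (cls d)) /= !Amul_cls -(linearZ_LR (cls d)) /=.
  by rewrite (linearZ_LR (hmul d _)).
- move=> x y z; have [[[x' ->] [y' ->]] [z' ->]] := (cls_surj d x, cls_surj d y, cls_surj d z).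
  by rewrite !Amul_cls hmulA.
- by split=> x; have [x' ->] := cls_surj d x; rewrite /Aone Amul_cls ?hmul1l ?hmul1r.
Qed.

Lemma Acomp_submodule d n : is_submodule (Acomp d n).
Proof.
split.
- by exists 0; [exact: hcomp0 | exact: (linear0 (cls d))].
- move=> _ _ [x hx <-] [y hy <-]; exists (x + y); first exact: hcompD.
  by rewrite clsD.
- move=> a _ [x hx <-]; exists (a *: x); first exact: hcompZ.
  exact: (linearZ_LR (cls d)).
Qed.

(** Independence: lift a vanishing sum of homogeneous classes and sort it; the
    sum of the sorted lifts is 0 in the free module, and the sorted lifts stay
    homogeneous, so that each of them is 0. *)
Lemma Acomp_direct_sum d : is_direct_sum (Acomp d).
Proof.
split=> [x|n f fC f0 i lin].
  have [y ->] := cls_surj d x; have [n yn] := sum_homog_parts y.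
  exists n, (fun i => cls d (homog_part i y)); split.
    by move=> i; exists (homog_part i y) => //; exact: hcomp_homog_part.
  by rewrite -(linear_sum (cls d)) -yn.
have /choice[g gP] : forall j, exists y, hcomp j y /\ cls d y = f j.
  by move=> j; have [y] := fC j; exists y.
have g0 : \sum_(j < n) sortop (g j) = 0.
  rewrite -(linear_sum sortop) /=; apply/(perm_idealE d).
  rewrite -[\sum_(j < n) _]subr0; apply/cls_eq.
  rewrite (linear_sum (cls d)) (linear0 (cls d)) -[RHS]f0.
  by apply: eq_bigr => j _; have [_ ] := gP j.
have [hi <-] := gP i; rewrite -cls_sortop.
have := congr1 (homog_part i) g0; rewrite (linear0 (homog_part i)) (linear_sum (homog_part i)).
rewrite (bigD1 (Ordinal lin)) //= big1 => [|j ji].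
  rewrite (homog_part_hcomp i) ?eqxx ?addr0 => [->|]; first exact: (linear0 (cls d)).
  exact: hcomp_sortop.
rewrite (homog_part_hcomp j); last by apply: hcomp_sortop; case: (gP j).
by case: eqP => // /eqP; rewrite -[i]/(val (Ordinal lin)) val_eqE (negPf ji).
Qed.

Lemma Acomp_grading d : is_algebra_grading (@Amul d) (Aone d) (Acomp d).
Proof.
split.
- exact: Acomp_submodule.
- exact: Acomp_direct_sum.
- by exists (hbasis [::]) => //; exact: (hcompU [::]).
- move=> m n _ _ [x hx <-] [y hy <-]; exists (hmul d x y); first exact: hcomp_hmul.
  by rewrite Amul_cls.
Qed.

Section PartitionBasis.
Context {n : nat}.

Definition sorted_lcomb : {malg Qq[Lambda n]} -> hatA :=
  lcomb (fun l : Lambda n => hbasis (val l)).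

Lemma lcomb_pcls d x : lcomb (@pcls d n) x = cls d (sorted_lcomb x).
Proof. by rewrite (linear_lcomb _ _ _ (cls d)). Qed.

Lemma sortop_sorted_lcomb x : sortop (sorted_lcomb x) = sorted_lcomb x.
Proof.
rewrite (linear_lcomb _ _ _ sortop); congr lcomb; apply/funext => l /=.
by rewrite sortopU (sorted_sort leq_trans) //; exact: (valP l).
Qed.

Lemma sorted_lcomb_inj x : sorted_lcomb x = 0 -> x = 0.
Proof.
move=> x0; apply/monalg.malgP => l; rewrite monalg.mcoeff0.
have := congr1 (monalg.mcoeff (val (val l))) x0; rewrite monalg.mcoeff0 => <-.
(* With l adjoined to the support, its term is there even if its coefficient is 0. *)
rewrite /sorted_lcomb (@lcombEw _ _ _ _ _ (l |` monalg.msupp x)%fset) ?fsubsetUr //.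
rewrite raddf_sum (bigD1_seq l) ?fset_uniq ?fset1U1 //= big1.
  by rewrite monalg.mcoeffZ monalg.mcoeffU eqxx mulr1 addr0.
move=> k kl; rewrite monalg.mcoeffZ monalg.mcoeffU.
by case: eqP => [/val_inj/val_inj/eqP|_]; rewrite ?(negPf kl) ?mulr0.
Qed.

Lemma hcomp_sorted_lcomb x : hcomp n (sorted_lcomb x).
Proof.
rewrite /sorted_lcomb /lcomb; apply: big_ind => [|y z|l _].
- exact: hcomp0.
- exact: hcompD.
- by apply: hcompZ; rewrite -[X in hcomp X](size_tuple (val l)); exact: hcompU.
Qed.

(** A combination of partitions is its own sorted form, so it vanishes in the
    quotient only if it vanishes in the free module; and every sequence has the
    class of its increasing rearrangement. *)
Lemma pcls_basis d : is_basis (Acomp d n) (@pcls d n).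
Proof.
split=> [x|].
  rewrite lcomb_pcls => /(esym) cx0; apply: sorted_lcomb_inj.
  rewrite -sortop_sorted_lcomb -(linear0 sortop); apply/(cls_eqP d).
  by rewrite -cx0 (linear0 (cls d)).
apply/seteqP; split=> [_ [y hy <-]|_ [x _ <-]]; last first.
  by rewrite lcomb_pcls; exists (sorted_lcomb x) => //; exact: hcomp_sorted_lcomb.
elim/hcomp_ind: hy => [|a u {}y su [x _ xy]].
  by exists 0 => //; rewrite (linear0 (lcomb _)) (linear0 (cls d)).
exists (a *: monalg.mkmalgU (incr_rearr (Tuple (introT eqP su))) 1 + x) => //.
by rewrite (linearP (lcomb _)) /= lcomb_mkmalgU xy -cls_hbasis_sorted (linearP (cls d)).
Qed.

End PartitionBasis.

Lemma Amul_pcls d m n (mu : Lambda m) (nu : Lambda n) :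
  Amul (pcls d mu) (pcls d nu) =
  \sum_(ab \in [set: m.-tuple nat * n.-tuple nat])
    ccoef d ab.1 ab.2 *:
      pcls d (incr_rearr [tuple of tadd (val mu) ab.1 ++ tadd (val nu) ab.2]).
Proof.
rewrite Amul_cls hmul_hbasis hstarE !size_tuple -ccoef_hbasis.
rewrite (ccoef_fsum d _ (fun ab => hbasis (tadd (val mu) ab.1 ++ tadd (val nu) ab.2))).
rewrite (linear_mpoly_lcomb _ _ _ (cls d)).
have -> : cls d \o ((fun ab => hbasis (tadd (val mu) ab.1 ++ tadd (val nu) ab.2))
                     \o mnm_split) =
          (fun ab => pcls d (incr_rearr
            [tuple of tadd (val mu) ab.1 ++ tadd (val nu) ab.2])) \o mnm_split.
  apply/funext => k; rewrite /comp.
  exact: (cls_hbasis_sorted d _ [tuple of _ ++ _]).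
by rewrite ccoef_fsum.
Qed.

Theorem proposition3p6 (d : nat) : (0 < d)%N ->
  [/\ is_assoc_unital_algebra (@Amul d) (Aone d),
      is_algebra_grading (@Amul d) (Aone d) (Acomp d),
      forall n : nat, is_basis (Acomp d n) (@pcls d n)
    & forall m n : nat, (0 < m)%N -> (0 < n)%N ->
      forall (mu : Lambda m) (nu : Lambda n),
        Amul (pcls d mu) (pcls d nu) =
        \sum_(ab \in [set: m.-tuple nat * n.-tuple nat])
          ccoef d ab.1 ab.2 *:
            pcls d (incr_rearr
              [tuple of tadd (val mu) ab.1 ++ tadd (val nu) ab.2])].
Proof.
move=> _; split=> [||n|m n _ _ mu nu].
- exact: Amul_assoc_unital.
- exact: Acomp_grading.
- exact: pcls_basis.
- exact: Amul_pcls.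
Qed.
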